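(* Let $A$ and $B$ be non-trivial groups, and let $H$ be an algebraic subgroup of the free product $A * B$. Then at least one of the following holds: (a) $H$ is either infinite cyclic or isomorphic to $D_\infty$, the infinite dihedral group. (b) $H$ is conjugate to a subgroup of either $A$ or $B$. (c) $H=A * B$.
   Context: Let $G$ be a group and $\langle x\rangle$ the infinite cyclic group generated by $x$. For $w(x)\in G*\langle x\rangle$ and $g\in G$, let $w(g)\in G$ be the image of $w(x)$ under the homomorphism $G*\langle x\rangle\to G$ which is the identity on $G$ and sends $x\mapsto g$. The primitive solution set corresponding to $w(x)$ is $\{g\in G \mid w(g)=1\}$. The Zariski topology on $G$ is the topology for which the primitive solution sets form a sub-basis of closed sets; thus each Zariski-closed set has the form $\bigcap_{i\in I}S_i$, where each $S_i$ is a finite union of primitive solution sets. A subset (in particular, a subgroup) of $G$ is called algebraic if it is Zariski-closed. *)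

(* Defs.v *)
From HB Require Import structures.
From mathcomp Require Import all_boot ssralg ssrint.
From mathcomp Require Import finmap boolp classical_sets cardinality filter topology.

Set Implicit Arguments.
Unset Strict Implicit.
Unset Printing Implicit Defensive.

Local Open Scope quotient_scope.
Local Open Scope classical_set_scope.
Local Open Scope group_scope.

(* All groups are of type groupType (possibly infinite groups); its choiceType
   component is no restriction, since the classical axioms of boolp equip every
   type with one. *)

Section FreeProduct.
Variables A B : groupType.

(* The free product is the free monoid of words over the disjoint union A + B
   modulo the smallest congruence that identifies products and units of A and
   of B with their values. *)
Inductive fp_cong : seq (A + B) -> seq (A + B) -> Prop :=
| fp_refl s : fp_cong s s
| fp_sym s t : fp_cong s t -> fp_cong t s
| fp_trans t s u : fp_cong s t -> fp_cong t u -> fp_cong s u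
| fp_cat s s' t t' :
    fp_cong s s' -> fp_cong t t' -> fp_cong (s ++ t) (s' ++ t')
| fp_mull a a' : fp_cong [:: inl a; inl a'] [:: inl (a * a')]
| fp_mulr b b' : fp_cong [:: inr b; inr b'] [:: inr (b * b')]
| fp_onel : fp_cong [:: inl 1] [::]
| fp_oner : fp_cong [:: inr 1] [::].

Definition fp_congb (s t : seq (A + B)) : bool := `[< fp_cong s t >].

Lemma fp_congb_refl : reflexive fp_congb.
Proof. by move=> s; apply/asboolP; exact: fp_refl. Qed.

Lemma fp_congb_sym : symmetric fp_congb.
Proof. by move=> s t; apply/asboolP/asboolP; exact: fp_sym. Qed.

Lemma fp_congb_trans : transitive fp_congb.
Proof.
by move=> t s u /asboolP st /asboolP tu; apply/asboolP; exact: fp_trans tu.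
Qed.

Canonical fp_equiv :=
  EquivRel fp_congb fp_congb_refl fp_congb_sym fp_congb_trans.

Definition free_product : Type := {eq_quot fp_equiv}.
HB.instance Definition _ := Choice.on free_product.

Definition fp_word (s : seq (A + B)) : free_product := \pi_({eq_quot fp_equiv}) s.
Definition fp_repr (x : free_product) : seq (A + B) :=
  repr (x : {eq_quot fp_equiv}).

Lemma fp_reprK x : fp_word (fp_repr x) = x.
Proof. exact: reprK. Qed.

Lemma fp_wordP s t : fp_word s = fp_word t <-> fp_cong s t.
Proof.
split=> [/eqmodP/asboolP//|st].
by apply/eqmodP; apply/asboolP.
Qed.

Lemma fp_repr_word s : fp_cong (fp_repr (fp_word s)) s.
Proof. by apply/fp_wordP; rewrite fp_reprK. Qed.

Definition fp_inv_letter (l : A + B) : A + B :=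
  match l with inl a => inl a^-1 | inr b => inr b^-1 end.
Definition fp_inv_word (s : seq (A + B)) : seq (A + B) :=
  rev (map fp_inv_letter s).

Definition fp_one : free_product := fp_word [::].
Definition fp_mul (x y : free_product) : free_product :=
  fp_word (fp_repr x ++ fp_repr y).
Definition fp_inv (x : free_product) : free_product :=
  fp_word (fp_inv_word (fp_repr x)).

Lemma fp_mulE s t : fp_mul (fp_word s) (fp_word t) = fp_word (s ++ t).
Proof. by apply/fp_wordP; apply: fp_cat; exact: fp_repr_word. Qed.

Lemma fp_inv_word_cong s t :
  fp_cong s t -> fp_cong (fp_inv_word s) (fp_inv_word t).
Proof.
rewrite /fp_inv_word; elim=> {s t}.
- by move=> s; exact: fp_refl.
- by move=> s t _; exact: fp_sym.
- by move=> t s u _ st _; exact: fp_trans.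
- by move=> s s' t t' _ ss _ tt; rewrite !map_cat !rev_cat; exact: fp_cat.
- by move=> a a'; rewrite /rev/= invgM; exact: fp_mull.
- by move=> b b'; rewrite /rev/= invgM; exact: fp_mulr.
- by rewrite /rev/= invg1; exact: fp_onel.
- by rewrite /rev/= invg1; exact: fp_oner.
Qed.

Lemma fp_invE s : fp_inv (fp_word s) = fp_word (fp_inv_word s).
Proof. by apply/fp_wordP; apply: fp_inv_word_cong; exact: fp_repr_word. Qed.

Lemma fp_inv_wordK s : fp_inv_word (fp_inv_word s) = s.
Proof.
rewrite /fp_inv_word map_rev revK -map_comp -[RHS]map_id; apply: eq_map.
by case=> c /=; rewrite invgK.
Qed.

Lemma fp_cong_mulV s : fp_cong (s ++ fp_inv_word s) [::].
Proof.
elim: s => [|l s IHs]; first exact: fp_refl.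
rewrite /fp_inv_word map_cons rev_cons -cats1 -/(fp_inv_word s).
rewrite -cat1s -catA (catA s); apply: (@fp_trans ([:: l] ++ [:: fp_inv_letter l])).
  apply: fp_cat; first exact: fp_refl.
  by rewrite -[X in fp_cong _ X]cat0s; apply: fp_cat => //; exact: fp_refl.
case: l => c /=.
- by apply: fp_trans (fp_mull _ _) _; rewrite mulgV; exact: fp_onel.
- by apply: fp_trans (fp_mulr _ _) _; rewrite mulgV; exact: fp_oner.
Qed.

Fact fp_mulA : associative fp_mul.
Proof.
move=> x y z; rewrite -[x]fp_reprK -[y]fp_reprK -[z]fp_reprK.
by rewrite !fp_mulE catA.
Qed.

Fact fp_mul1 : left_id fp_one fp_mul.
Proof. by move=> x; rewrite -[x]fp_reprK /fp_one fp_mulE. Qed.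

Fact fp_mulr1 : right_id fp_one fp_mul.
Proof. by move=> x; rewrite -[x]fp_reprK /fp_one fp_mulE cats0. Qed.

Fact fp_mulrV : right_inverse fp_one fp_inv fp_mul.
Proof.
move=> x; rewrite -[x]fp_reprK fp_invE fp_mulE.
by apply/fp_wordP; exact: fp_cong_mulV.
Qed.

Fact fp_mulVr : left_inverse fp_one fp_inv fp_mul.
Proof.
move=> x; rewrite -[x]fp_reprK fp_invE fp_mulE -{2}[fp_repr x]fp_inv_wordK.
by apply/fp_wordP; exact: fp_cong_mulV.
Qed.

HB.instance Definition _ := isGroup.Build free_product
  fp_mulA fp_mul1 fp_mulr1 fp_mulVr fp_mulrV.

HB.instance Definition _ := isPointed.Build free_product (1 : free_product).

Definition fp_inl (a : A) : free_product := fp_word [:: inl a].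
Definition fp_inr (b : B) : free_product := fp_word [:: inr b].

Fact fp_inlM : {morph fp_inl : x y / x * y}.
Proof.
move=> x y; rewrite [RHS]fp_mulE; apply/fp_wordP; apply: fp_sym.
exact: fp_mull.
Qed.
HB.instance Definition _ := isMultiplicative.Build A free_product fp_inl fp_inlM.

Fact fp_inrM : {morph fp_inr : x y / x * y}.
Proof.
move=> x y; rewrite [RHS]fp_mulE; apply/fp_wordP; apply: fp_sym.
exact: fp_mulr.
Qed.
HB.instance Definition _ := isMultiplicative.Build B free_product fp_inr fp_inrM.

Section Lift.
Variables (K : groupType).
Variables (f : {multiplicative A -> K}) (g : {multiplicative B -> K}).

Definition fp_lift_letter (l : A + B) : K :=
  match l with inl a => f a | inr b => g b end.
Definition fp_lift_word (s : seq (A + B)) : K :=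
  \prod_(l <- s) fp_lift_letter l.

Definition fp_lift (x : free_product) : K := fp_lift_word (fp_repr x).

Let morph1 (G : groupType) (h : {multiplicative G -> K}) : h 1 = 1.
Proof. by apply: (mulgI (h 1)); rewrite -gmulfM !mulg1. Qed.

Lemma fp_lift_cong s t : fp_cong s t -> fp_lift_word s = fp_lift_word t.
Proof.
rewrite /fp_lift_word; elim=> {s t} //.
- by move=> t s u _ -> _ ->.
- by move=> s s' t t' _ es _ et; rewrite !big_cat /= es et.
- by move=> a a'; rewrite !big_cons big_nil /= !mulg1 gmulfM.
- by move=> b b'; rewrite !big_cons big_nil /= !mulg1 gmulfM.
- by rewrite big_cons big_nil /= mulg1 morph1.
- by rewrite big_cons big_nil /= mulg1 morph1.
Qed.

Lemma fp_lift_wordE s : fp_lift (fp_word s) = fp_lift_word s.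
Proof. by apply: fp_lift_cong; exact: fp_repr_word. Qed.

Fact fp_liftM : {morph fp_lift : x y / x * y}.
Proof.
move=> x y; rewrite -[x]fp_reprK -[y]fp_reprK [X in fp_lift X]fp_mulE.
by rewrite !fp_lift_wordE /fp_lift_word big_cat.
Qed.
HB.instance Definition _ :=
  isMultiplicative.Build free_product K fp_lift fp_liftM.

Lemma fp_lift_inl a : fp_lift (fp_inl a) = f a.
Proof. by rewrite fp_lift_wordE /fp_lift_word big_cons big_nil /= mulg1. Qed.

Lemma fp_lift_inr b : fp_lift (fp_inr b) = g b.
Proof. by rewrite fp_lift_wordE /fp_lift_word big_cons big_nil /= mulg1. Qed.

Lemma fp_lift_uniq (h : {multiplicative free_product -> K}) :
  (forall a, h (fp_inl a) = f a) -> (forall b, h (fp_inr b) = g b) ->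
  forall x, h x = fp_lift x.
Proof.
move=> hl hr x; rewrite -[x]fp_reprK fp_lift_wordE /fp_lift_word.
elim: (fp_repr x) => [|l s IHs]; first by rewrite big_nil; exact: morph1.
rewrite big_cons -IHs -cat1s -fp_mulE [LHS]gmulfM; congr (_ * _).
by case: l => c; [exact: hl|exact: hr].
Qed.

End Lift.
End FreeProduct.

Arguments fp_inl {A} B a.
Arguments fp_inr A {B} b.

Notation inf_cyclic := (Algebra.to_multiplicative int).

Definition inf_cyclic_gen : inf_cyclic := 1%R : int.

Section ZPower.
Variable G : groupType.

Definition zpow (g : G) (n : inf_cyclic) : G :=
  match (n : int) with Posz k => g ^+ k | Negz k => (g ^+ k.+1)^-1 end.

Lemma zpow_sub g (k l : nat) : zpow g (k%:Z - l%:Z)%R = g ^+ k / g ^+ l.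
Proof.
have [lk|/ltnW kl] := leqP l k.
  by rewrite subzn //= -[in RHS](subnK lk) expgnDr mulgK.
rewrite -GRing.opprB subzn // -[in RHS](subnK kl) expgnDr invgM mulVKg.
by case: (l - k)%N => [|d] //=; rewrite invg1.
Qed.

Fact zpowM g : {morph zpow g : m n / m * n}.
Proof.
have subE (m : int) : exists k l : nat, m = (k%:Z - l%:Z)%R.
  case: m => k; first by exists k, 0%N; rewrite GRing.subr0.
  by exists 0%N, k.+1; rewrite NegzE GRing.sub0r.
move=> m n; have [k [l em]] := subE m; have [k' [l' en]] := subE n.
have -> : m * n = ((k + k')%N%:Z - (l' + l)%N%:Z)%R :> inf_cyclic.
  by rewrite em en [LHS]GRing.addrACA -GRing.opprD (addnC l') !PoszD.
rewrite em en !zpow_sub !expgnDr invgM !mulgA; congr (_ / _).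
rewrite -!mulgA; congr (_ * _).
have /commuteV : commute (g ^+ k') (g ^+ l) by exact/commuteX2.
by move=> ->.
Qed.

HB.instance Definition _ (g : G) :=
  isMultiplicative.Build inf_cyclic G (zpow g) (zpowM g).

End ZPower.

(* An element w of free_product G inf_cyclic is an equation w(x), where x is
   fp_inr G inf_cyclic_gen. *)
Definition word_eval (G : groupType) (g : G)
    (w : free_product G inf_cyclic) : G :=
  fp_lift (idfun : {multiplicative G -> G})
          (zpow g : {multiplicative inf_cyclic -> G}) w.

Lemma word_eval_const (G : groupType) (g a : G) :
  word_eval g (fp_inl inf_cyclic a) = a.
Proof. exact: fp_lift_inl. Qed.

Lemma word_eval_var (G : groupType) (g : G) :
  word_eval g (fp_inr G inf_cyclic_gen) = g.
Proof. exact: fp_lift_inr. Qed.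

Definition primitive_solution_set (G : groupType)
    (w : free_product G inf_cyclic) : set G :=
  [set g | word_eval g w = 1].

Definition zariski (G : groupType) : Type := G.
HB.instance Definition _ (G : groupType) := Choice.on (zariski G).

(* The library generates a topology from a sub-basis of open sets. *)
HB.instance Definition _ (G : groupType) :=
  isSubBaseTopological.Build (zariski G)
    setT (fun w : free_product G inf_cyclic => ~` primitive_solution_set w).

Definition algebraic (G : groupType) (S : set G) : Prop :=
  closed (S : set (zariski G)).

Lemma algebraicP (G : groupType) (S : set G) :
  algebraic S <->
  exists F : set (seq (free_product G inf_cyclic)),
    S = \bigcap_(s in F) \bigcup_(w in [set` s]) primitive_solution_set w.
Proof.
have solC w : closed (primitive_solution_set w : set (zariski G)).
  rewrite -[X in closed X]setCK; apply: open_closedC.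
  exists [set ~` primitive_solution_set w]; last by rewrite bigcup_set1.
  by move=> _ ->; exact: finI_from1.
split=> [/closed_openC[D' D'D e]|[F ->]].
  exists [set s | D' (~` \bigcup_(w in [set` s]) primitive_solution_set w)].
  apply: setC_inj; rewrite -e setC_bigcap; apply/seteqP; split=> g [].
    move=> U D'U Ug; have [X _ XU] := D'D _ D'U.
    have UE : ~` (\bigcup_(w in [set` enum_fset X]) primitive_solution_set w) = U.
      by rewrite setC_bigcup -XU.
    exists (enum_fset X); first by rewrite /= UE.
    by have : U g := Ug; rewrite -UE.
  by move=> s /= D's Us; exists (~` \bigcup_(w in [set` s]) primitive_solution_set w).
apply: closed_bigI => s _; apply: closed_bigcup => //; exact: finite_seq.
Qed.

Definition subgroup (G : groupType) (H : set G) : Prop :=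
  group_closed [in H].

Definition isomorphic_to (K G : groupType) (H : set G) : Prop :=
  exists f : {multiplicative K -> G}, injective f /\ range f = H.

(* The infinite dihedral group, as the semidirect product of int by the group
   of order 2 acting by negation. *)
Definition inf_dihedral : Type := (int * bool)%type.
HB.instance Definition _ := Choice.on inf_dihedral.

Definition dih_one : inf_dihedral := (0%R, false).
Definition dih_mul (x y : inf_dihedral) : inf_dihedral :=
  ((x.1 + (-1) ^+ x.2 * y.1)%R, x.2 (+) y.2).
Definition dih_inv (x : inf_dihedral) : inf_dihedral :=
  ((- ((-1) ^+ x.2 * x.1))%R, x.2).

Fact dih_mulA : associative dih_mul.
Proof.
move=> [m s] [n t] [p u]; rewrite /dih_mul /= addbA; congr (_, _).
by rewrite GRing.mulrDr GRing.addrA GRing.mulrA GRing.signr_addb.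
Qed.

Fact dih_mul1 : left_id dih_one dih_mul.
Proof. by case=> m s; rewrite /dih_mul /= GRing.mul1r GRing.add0r. Qed.

Fact dih_mulr1 : right_id dih_one dih_mul.
Proof. by case=> m s; rewrite /dih_mul /= GRing.mulr0 GRing.addr0 addbF. Qed.

Fact dih_mulVr : left_inverse dih_one dih_inv dih_mul.
Proof. by case=> m s; rewrite /dih_mul /= GRing.addNr addbb. Qed.

Fact dih_mulrV : right_inverse dih_one dih_inv dih_mul.
Proof.
case=> m s; rewrite /dih_mul /= addbb; congr (_, _).
by rewrite GRing.mulrN GRing.signrMK GRing.subrr.
Qed.

HB.instance Definition _ := isGroup.Build inf_dihedral
  dih_mulA dih_mul1 dih_mulr1 dih_mulVr dih_mulrV.

(* Main.v *)
(* Syllable length makes G = A * B act on a tree with trivial edge stabilizers.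
   If H contains no hyperbolic element, it fixes a vertex, which is (b).
   Otherwise let u be a hyperbolic element of H; since edge stabilizers are
   trivial, the stabilizer E(u) of its axis consists of the f such that
   f u f^-1 is u or u^-1, and the centralizer of u is infinite cyclic. If H lies
   in E(u), then (a) holds. Otherwise an element g of H outside E(u) moves the
   axis, and for large m the axis of u' = (g u^m)^-1 u (g u^m) is preserved by
   none of finitely many given non-trivial elements. A non-trivial equation is a
   constant or has the form a x^n0 g1 x^n1 ... gk x^nk b with g_i <> 1 and
   n_i <> 0; choosing u' for the g_i, a ping-pong estimate shows that x = u'^N
   is not a solution for N large. This works for finitely many equations at
   once, so a finite union of solution sets that contains H is all of G, and
   (c) holds. *)

From HB Require Import structures.
Require Import Defs.
From mathcomp Require Import all_boot ssralg ssrint classical_sets.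
From mathcomp Require Import boolp zify.

Set Implicit Arguments.
Unset Strict Implicit.
Unset Printing Implicit Defensive.

Local Open Scope classical_set_scope.
Local Open Scope group_scope.

(** * Integer powers and subgroups *)

Section IntegerPowers.
Variable G : groupType.
Implicit Types (g h : G) (m n : int).

Lemma zpowD g m n : zpow g (m + n)%R = zpow g m * zpow g n.
Proof. exact: zpowM. Qed.

Lemma zpow1 g : zpow g 1%R = g.
Proof. by []. Qed.

Lemma zpowN g n : zpow g (- n)%R = (zpow g n)^-1.
Proof.
by apply: (mulIg (zpow g n)); rewrite -zpowD GRing.addNr mulVg.
Qed.

Lemma zpowC g m n : zpow g m * zpow g n = zpow g n * zpow g m.
Proof. by rewrite -!zpowD GRing.addrC. Qed.

Lemma zpowX g (k : nat) n : zpow (g ^+ k) n = zpow g (k%:Z * n)%R.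
Proof.
have posE (j : nat) : zpow (g ^+ k) j = zpow g (k%:Z * j%:Z)%R.
  by rewrite -PoszM /= expgnA.
by case: n => j; rewrite ?NegzE ?GRing.mulrN ?zpowN posE.
Qed.

Lemma zpowJ g h n : zpow (g ^ h) n = zpow g n ^ h.
Proof. by case: n => j /=; rewrite ?conjVg conjXg. Qed.

Lemma zpowM_exp g m n : zpow (zpow g m) n = zpow g (m * n)%R.
Proof.
case: m => k; first exact: zpowX.
rewrite NegzE GRing.mulNr !zpowN -[zpow g (k.+1%:Z * n)%R]zpowX.
by case: n => j; rewrite ?NegzE ?zpowN ?invgK /= expVgn ?invgK.
Qed.

End IntegerPowers.

Section Subgroups.
Variables (G : groupType) (H : set G).
Hypothesis gH : subgroup H.

Lemma subgroup1 : H 1.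
Proof. by case: gH => /set_mem. Qed.

Lemma subgroupV x : H x -> H x^-1.
Proof. by move=> Hx; apply/set_mem/(group_closedV gH)/mem_set. Qed.

Lemma subgroupM x y : H x -> H y -> H (x * y).
Proof.
by move=> Hx Hy; apply/set_mem/(group_closedM gH); apply: mem_set.
Qed.

Lemma subgroupX x k : H x -> H (x ^+ k).
Proof.
move=> Hx; elim: k => [|k IH]; first exact: subgroup1.
by rewrite expgS; apply: subgroupM.
Qed.

End Subgroups.

Lemma subgroup_closed (G : groupType) (H : set G) :
  H 1 -> (forall x, H x -> H x^-1) -> (forall x y, H x -> H y -> H (x * y)) ->
  subgroup H.
Proof.
move=> H1 HV HM; split=> [|x y]; rewrite ?inE //.
by move=> Hx Hy; apply/HM/HV.
Qed.

Lemma subgroup_centralizer (G : groupType) (H : set G) (u : G) :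
  subgroup H -> subgroup [set x | H x /\ commute x u].
Proof.
move=> gH; apply: subgroup_closed => [|x [Hx xu]|x y [Hx xu] [Hy yu]].
- by split; [exact: subgroup1|rewrite /commute mul1g mulg1].
- by split; [exact: subgroupV|apply/commute_sym/commuteV/commute_sym].
- by split; [exact: subgroupM|apply/commute_sym/commuteM; exact: commute_sym].
Qed.

Lemma subgroup_conj (G : groupType) (H : set G) (y : G) :
  subgroup H -> subgroup [set h ^ y | h in H].
Proof.
move=> gH; apply: subgroup_closed => [|_ [h Hh <-]|_ _ [h Hh <-] [k Hk <-]].
- by exists 1; [exact: subgroup1|rewrite conj1g].
- by exists h^-1; [exact: subgroupV|rewrite conjVg].
- by exists (h * k); [exact: subgroupM|rewrite conjMg].
Qed.

(** * Tree-like length functions *)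

(* [L x] plays the role of the distance from a base point [o] to [x o] in a
   tree on which [G] acts with trivial stabilizer of [o]; the first clause is
   that triviality and the last one is the four-point condition of trees. *)
Definition tree_length (G : groupType) (L : G -> nat) : Prop :=
  [/\ forall x, L x = 0 <-> x = 1,
      forall x, L x^-1 = L x &
      forall x y z, L (x^-1 * z) + L y <=
        maxn (L z + L (x^-1 * y)) (L x + L (y^-1 * z))].

Section TreeLength.
Variables (G : groupType) (L : G -> nat).
Hypothesis treeL : tree_length L.
Implicit Types (x y z t u v f g : G) (i k n m : nat).

Definition tree_dist (x y : G) : nat := L (x^-1 * y).
Local Notation d := tree_dist.

Let L0 x : L x = 0 -> x = 1. Proof. by case: treeL => /(_ x) []. Qed.
Let L1 : L 1 = 0. Proof. by case: treeL => /(_ 1) [] _ ->. Qed.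
Let LV x : L x^-1 = L x. Proof. by case: treeL. Qed.

Let mulA x y z : x * (y * z) = x * y * z. Proof. exact: mulgA. Qed.

Lemma tree_dist1 x : d 1 x = L x.
Proof. by rewrite /d invg1 mul1g. Qed.

Lemma tree_distC x y : d x y = d y x.
Proof. by rewrite /d -LV invgM invgK. Qed.

Lemma tree_distM z x y : d (z * x) (z * y) = d x y.
Proof. by rewrite /d invgM -mulgA mulKg. Qed.

Lemma tree_dist0 x y : d x y = 0 -> x = y.
Proof. by move/L0/mulg1_eq; rewrite invgK. Qed.

(** Translating by [t^-1] makes [t] the base point. *)
Lemma four_point x y z t :
  d x z + d y t <= maxn (d z t + d x y) (d x t + d y z).
Proof.
case: treeL => _ _ /(_ (t^-1 * x) (t^-1 * y) (t^-1 * z)).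
by rewrite -/(d _ _) -!/(d _ _) !tree_distM ![d _ t]tree_distC.
Qed.

Lemma tree_triangle y x z : d x z <= d x y + d y z.
Proof.
have := four_point x y z y; rewrite {2}/d mulVg L1 (tree_distC z y); lia.
Qed.

Lemma tree_lengthM x y : L (x * y) <= L x + L y.
Proof.
by have := tree_triangle x 1 (x * y); rewrite !tree_dist1 /d mulKg.
Qed.


(** The four-point condition for [x], [z], [y], [t] forces [d z t = 0]: a geodesic has one point at
    each distance from its origin. *)
Lemma tree_between x y z t :
  d x z + d z y = d x y -> d x t + d t y = d x y -> d x z = d x t -> z = t.
Proof.
move=> xzy xty xzt; apply: tree_dist0.
have := four_point x z y t; rewrite (tree_distC y t); lia.
Qed.

(** * Axial elements and overlaps of their axes *)

(** In tree terms, [u] is hyperbolic and its axis passes through the base point. *)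
Definition axial (u : G) : Prop := L (u ^+ 2) = (2 * L u)%N /\ 0 < L u.

Lemma axialV u : axial u -> axial u^-1.
Proof. by case=> u2 u0; split; rewrite ?expVgn !LV. Qed.

Lemma tree_distX u i k : i <= k -> d (u ^+ i) (u ^+ k) = L (u ^+ (k - i)).
Proof. by move=> ik; rewrite -{1}(subnKC ik) expgnDr /d mulKg. Qed.

(** The four-point condition for 1, u, u^(n+2), u^(n+3) gives the lower bound, the triangle
    inequality the upper one. *)
Lemma tree_lengthX u n : axial u -> L (u ^+ n) = (n * L u)%N.
Proof.
case=> u2 _; elim/ltn_ind: n => -[|[|[|n]]] IH //; first by rewrite mul1n.
have E1 := IH n.+1 (ltnW (ltnSn _)); have E2 := IH n.+2 (ltnSn _).
have := four_point 1 (u ^+ 1) (u ^+ n.+2) (u ^+ n.+3).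
have := tree_lengthM u (u ^+ n.+2); rewrite -expgS.
rewrite !tree_dist1 !tree_distX // !subSS subn0 ?subSnn !expg1 E1 E2.
clear -n; move: (L u) (L _) => l x; nia.
Qed.

Lemma tree_length_zpow u (n : int) :
  axial u -> L (zpow u n) = (absz n * L u)%N.
Proof. by move=> axu; case: n => k; rewrite /= ?LV tree_lengthX. Qed.

(* If the axes of [u] and of [f v f^-1], which have the same translation
   length, overlap for long enough, then [f v f^-1] and [u] move a point of the
   overlap in the same way, so that they are equal. *)
Lemma long_overlap u v f n m :
  axial u -> axial v -> L u = L v ->
  L (u ^- n * (f * v ^+ m)) + 2 * (L f).+1 * L u <=
    L (u ^+ n) + L (f * v ^+ m) ->
  f * v = u * f.
Proof.
move=> axu axv uv; have [_ u0] := axu; set i := L f => long.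
have tl := @tree_triangle.
pose Q := f * v ^+ m; pose Q1 := f * v ^+ m.+1; pose p1 := f * v * f^-1 * u ^+ i.
have oP : L (u ^+ n) = (n * L u)%N by exact: tree_lengthX.
have oQ : L Q <= i + m * L u.
  by rewrite uv -tree_lengthX //; exact: tree_lengthM.
have oP' : L (u ^+ n) <= L (u ^- n * Q) + L Q.
  by have := tl Q 1 (u ^+ n); rewrite !tree_dist1 tree_distC /d; lia.
have oQ' : L Q <= L (u ^- n * Q) + L (u ^+ n).
  by have := tl (u ^+ n) 1 Q; rewrite !tree_dist1 /d; lia.
have ltin : i < n by rewrite -/Q in long; nia.
have FQ : d f Q = (m * L u)%N by rewrite /d mulKg tree_lengthX // uv.
have FQ1 : d f Q1 = (m.+1 * L u)%N by rewrite /d mulKg tree_lengthX // uv.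
have QQ1 : d Q Q1 = L u by rewrite tree_distM tree_distX // subSnn expg1.
(* By [long], these points of the axis of [u] lie on the geodesic from 1 to [Q]. *)
have onQ j : j <= i.+1 -> d 1 (u ^+ j) + d (u ^+ j) Q = d 1 Q.
  move=> ji; have := four_point 1 Q (u ^+ n) (u ^+ j).
  have := tl (u ^+ j) 1 Q.
  rewrite !tree_dist1 (tree_distC (u ^+ n) (u ^+ j)) (tree_distC Q (u ^+ n)).
  rewrite (tree_distC Q (u ^+ j)) tree_distX ?tree_lengthX //; last lia.
  rewrite [d (u ^+ n) Q]/d -/Q in long *.
  have nj : (n * L u = j * L u + (n - j) * L u)%N.
    by rewrite -mulnDl subnKC //; lia.
  have ji' : j * L u <= i.+1 * L u by rewrite leq_mul2r ji orbT.
  lia.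
have ii : i <= i * L u by rewrite leq_pmulr.
(* From [j = i] on, [u ^+ j] is at distance at least [L f] from 1, hence also lies on the geodesic
   from [f] to [Q]. *)
have onFQ j : i <= j <= i.+1 -> d f (u ^+ j) + d (u ^+ j) Q = d f Q.
  move=> /andP[ij ji]; have := onQ j ji; have := four_point f 1 (u ^+ j) Q.
  have := tl (u ^+ j) f Q; have := tl f (u ^+ j) Q.
  rewrite (tree_distC f 1) (tree_distC (u ^+ j) f) !tree_dist1 tree_lengthX //.
  have ij' : i * L u <= j * L u by rewrite leq_mul2r ij orbT.
  lia.
have s0 := onFQ i; have s1 := onFQ i.+1; have t0 := onQ i; have t1 := onQ i.+1.
rewrite !tree_dist1 !tree_lengthX // in t0 t1.
have F1p1 : d (f * v) p1 = d f (u ^+ i).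
  by rewrite /p1 -mulgA /d mulKg.
have p1Q1 : d p1 Q1 = d (u ^+ i) Q.
  by rewrite (_ : Q1 = f * v * f^-1 * Q) ?tree_distM // /Q mulgA mulgVK -mulgA -expgS.
have FF1 : d f (f * v) = L u by rewrite /d mulKg uv.
have := tl (f * v) f p1; have := tl p1 f Q1; have := tl Q (u ^+ i.+1) Q1.
have := tl (u ^+ i.+1) f Q1.
move=> a1 a2 a3 a4.
(* Both points lie on the geodesic from [f] to [Q1], at distance [d f (u ^+ i) + L u] from [f]. *)
have e : u ^+ i.+1 = p1.
  apply: (@tree_between f Q1); lia.
by move: e; rewrite expgS /p1 => /mulIg ->; rewrite mulgVK.
Qed.


Lemma short_overlap u v f n m :
  axial u -> axial v -> L u = L v -> f * v <> u * f ->
  (n + m) * L u <= L (u ^- n * (f * v ^+ m)) + (2 * (L f).+1 * L u + L f).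
Proof.
move=> axu axv uv nfuv; rewrite leqNgt; apply/negP => long; apply: nfuv.
apply: (@long_overlap u v f n m) => //.
have := tree_lengthM f^-1 (f * v ^+ m).
rewrite LV mulKg !tree_lengthX // -uv; rewrite mulnDl in long; lia.
Qed.

Lemma zpow_sign u (n : int) :
  exists2 v, v = u \/ v = u^-1 & zpow u n = v ^+ absz n.
Proof.
by case: n => k; [exists u; [left|]|exists u^-1; [right|rewrite expVgn]].
Qed.

(* For axial [u], these are the elements that preserve the axis of [u]. *)
Definition axis_stab (u f : G) : Prop := f * u = u * f \/ f * u = u^-1 * f.

(** Cancellation around [f] is bounded independently of the exponents: [short_overlap] applies with
    [u] or [u^-1] on each side, since each of the four equalities [f * v = w * f] would put [f] in
    [axis_stab u]. *)
Lemma overlap_bound u f :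
  axial u -> ~ axis_stab u f ->
  exists K, forall n m : int,
    (absz n + absz m) * L u <= L (zpow u n * f * zpow u m) + K.
Proof.
move=> axu nuf; exists (2 * (L f).+1 * L u + L f)%N => n m.
have [v vu ->] := zpow_sign u m.
have [w wu] := zpow_sign u (- n)%R.
rewrite zpowN abszN => /(canRL invgK) ->.
have uE x : x = u \/ x = u^-1 -> axial x /\ L x = L u.
  by case=> ->; rewrite ?LV; split=> //; apply: axialV.
have [axv Lv] := uE v vu; have [axw Lw] := uE w wu.
rewrite -mulA -Lw; apply: short_overlap => //; first by rewrite Lv.
move=> fvw; apply: nuf; case: vu wu fvw => -> [] -> fvw.
- by left.
- by right.
- by right; apply: (mulgI u); rewrite mulVKg mulA -fvw mulgVK.
- by left; apply: (mulgI u^-1); rewrite mulKg mulA -fvw mulgVK.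
Qed.

(** * Ping-pong estimates *)

(** The value at x = h of the tail g1 x^n1 ... gk x^nk of an equation. *)
Definition tail_eval (h : G) (l : seq (G * int)) : G :=
  \prod_(p <- l) (p.1 * zpow h p.2).

(** Induction on [l], by the four-point condition for u^-m, 1, g u^m1, g u^m1 T with T the remaining
    tail. The hypothesis [2 * K < N] excludes one alternative; the other bounds the cancellation by
    [2 * K]. *)
Lemma tail_eval_long u (l : seq (G * int)) K N (n : int) :
    axial u -> 2 * K < N -> n != 0%R ->
    {in l, forall p : G * int, [/\ p.2 != 0%R, L p.1 <= K & forall i j : int,
      (absz i + absz j) * L u <= L (zpow u i * p.1 * zpow u j) + K]} ->
  L (tail_eval (u ^+ N) l) + N * absz n * L u <=
    L (zpow (u ^+ N) n * tail_eval (u ^+ N) l) + 2 * K.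
Proof.
move=> axu KN; have [_ u0] := axu; elim: l n => [|[g n1] l IH] n n0 lP.
  rewrite /tail_eval big_nil mulg1 L1 zpowX tree_length_zpow // abszM; lia.
have [/= n10 Lg gP] := lP (g, n1) (mem_head _ _).
have {}IH : L (tail_eval (u ^+ N) l) + N * absz n1 * L u <=
    L (zpow (u ^+ N) n1 * tail_eval (u ^+ N) l) + 2 * K.
  by apply: IH => // p pl; apply: lP; rewrite inE pl orbT.
rewrite /tail_eval big_cons /= -/(tail_eval _ _) -mulA !zpowX in IH *.
set T := tail_eval _ _ in IH *; set m := (N%:Z * n)%R; set m1 := (N%:Z * n1)%R in IH *.
have mE : absz m = (N * absz n)%N by rewrite abszM.
have m1E : absz m1 = (N * absz n1)%N by rewrite abszM.
have m1N : N <= absz m1 * L u by rewrite m1E -mulnA leq_pmulr // muln_gt0 u0 absz_gt0 n10.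
rewrite -{}mE -{}m1E in IH *.
have {}gP := gP m m1.
have := four_point (zpow u (- m)%R) 1 (g * zpow u m1) (g * (zpow u m1 * T)).
have dm x : d (zpow u (- m)%R) x = L (zpow u m * x) by rewrite /d zpowN invgK.
have qr : d (g * zpow u m1) (g * (zpow u m1 * T)) = L T.
  by rewrite tree_distM /d mulKg.
rewrite !tree_dist1 !dm qr mulg1 tree_length_zpow //.
have := tree_lengthM g (zpow u m1); rewrite tree_length_zpow //.
have := tree_lengthM g^-1 (g * (zpow u m1 * T)); rewrite LV mulKg.
rewrite -mulA mulnDl in gP. lia.
Qed.

(** One [K] serves all of [l]; once [N] exceeds [2 * K + L b], the left side is longer than [b]. *)
Lemma tail_eval_neq u (l : seq (G * int)) b :
  axial u -> {in l, forall p : G * int, p.2 != 0%R /\ ~ axis_stab u p.1} ->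
  exists N0, forall N (n : int), N0 < N -> n != 0%R ->
    zpow (u ^+ N) n * tail_eval (u ^+ N) l <> b.
Proof.
move=> axu lP.
have [K KP] : exists K, {in l, forall p : G * int,
    [/\ p.2 != 0%R, L p.1 <= K & forall i j : int,
      (absz i + absz j) * L u <= L (zpow u i * p.1 * zpow u j) + K]}.
  elim: l lP => [_|[g n] l IH lP]; first by exists 0.
  have [p pl|K1 K1P] := IH; first by apply: lP; rewrite inE pl orbT.
  have [/= n0 /(overlap_bound axu)[K2 K2P]] := lP (g, n) (mem_head _ _).
  exists (L g + K1 + K2)%N => p; rewrite inE => /orP[/eqP ->|/K1P[p2 p1 pP]].
    by split=> //= [|i j]; [lia|have := K2P i j; lia].
  by split=> //= [|i j]; [lia|have := pP i j; lia].
have [_ u0] := axu.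
exists (2 * K + L b)%N => N n Nlt n0 e.
have NK : 2 * K < N by lia.
have := tail_eval_long axu NK n0 KP; rewrite e.
have : N <= N * absz n * L u by rewrite -mulnA leq_pmulr // muln_gt0 absz_gt0 n0.
lia.
Qed.

(** * Centralizers of axial elements *)

(** Since [c] preserves the axis of [u], it lies on the segment from u^-k to u^k. *)
Lemma centralizer_axis u c k :
  axial u -> commute c u -> L c < k ->
  L (u ^+ k * c) + L (u ^- k * c) = (2 * (k * L u))%N.
Proof.
move=> axu cu Lck; have [_ u0] := axu.
have cuk : c * u ^+ k = u ^+ k * c by apply: commuteX.
have c_ukc : d c (u ^+ k * c) = (k * L u)%N.
  by rewrite -cuk /d mulKg tree_lengthX.
have ukc_uk : d (u ^+ k * c) (u ^+ k) = L c.
  by rewrite -[X in d _ X]mulg1 tree_distM tree_distC tree_dist1.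
have := four_point c 1 (u ^+ k * c) (u ^+ k).
have := four_point c 1 (u ^+ k) (u ^+ k * c).
have c_uk : d c (u ^+ k) = L (u ^- k * c) by rewrite tree_distC.
rewrite (tree_distC (u ^+ k) (u ^+ k * c)) c_ukc ukc_uk c_uk (tree_distC c 1).
rewrite !tree_dist1 tree_lengthX //.
have : k <= k * L u by rewrite leq_pmulr.
lia.
Qed.

(** On the segment from u^-k to u^k, the distance of two points is the difference of their distances
    from u^-k. *)
Lemma centralizer_dist u c g k :
  axial u -> commute c u -> commute g u -> L c < k -> L g < k ->
  L (u ^+ k * c) <= L (u ^+ k * g) ->
  L (c^-1 * g) + L (u ^+ k * c) = L (u ^+ k * g).
Proof.
move=> axu cu gu Lc Lg le_cg.
have Ec := centralizer_axis axu cu Lc; have Eg := centralizer_axis axu gu Lg.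
have pd x : d (u ^- k) x = L (u ^+ k * x) by rewrite /d invgK.
have qd x : d (u ^+ k) x = L (u ^- k * x) by [].
have := four_point c (u ^- k) g (u ^+ k).
have := tree_triangle c (u ^- k) g.
have pq : L (u ^+ k * u ^+ k) = (2 * (k * L u))%N.
  by rewrite -expgnDr tree_lengthX // mulnDl; lia.
rewrite (tree_distC c (u ^+ k)) (tree_distC c (u ^- k)) (tree_distC g (u ^+ k)).
rewrite !pd !qd pq -!/(d c g); lia.
Qed.

(** Comparison with the point 1: [c] lies ahead of it or behind it on the axis. *)
Lemma centralizer_length u c k :
  axial u -> commute c u -> L c < k ->
  L (u ^+ k * c) = (k * L u + L c)%N \/ L (u ^+ k * c) + L c = (k * L u)%N.
Proof.
move=> axu cu Lck; have k0 : L 1 < k by rewrite L1; lia.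
have := centralizer_dist axu cu (commute_sym (commute1 u)) Lck k0.
have := centralizer_dist axu (commute_sym (commute1 u)) cu k0 Lck.
rewrite !mulg1 invg1 mul1g LV tree_lengthX //; lia.
Qed.

(** Elements of [H] are points of the axis, so Euclid's algorithm applies: [c] is non-trivial of
    least length, and multiplying [g <> 1] by [c] or [c^-1] shortens it. *)
Lemma centralizer_cyclic u (H : set G) :
  axial u -> subgroup H -> H u -> (forall g, H g -> commute g u) ->
  exists2 c, H c & (forall g, H g -> exists n : int, g = zpow c n) /\
    (forall n : int, zpow c n = 1 -> n = 0%R).
Proof.
move=> axu gH Hu HC; have [_ u0] := axu.
have HV x : H x -> H x^-1 by apply: subgroupV.
have HM x y : H x -> H y -> H (x * y) by apply: subgroupM.
pose P k := `[< exists c, [/\ H c, c <> 1 & L c = k] >].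
have exP : exists k, P k.
  by exists (L u); apply/asboolP; exists u; split=> // u1; rewrite u1 L1 in u0.
have [k /asboolP[c [Hc c1 Lc]] min_c] := ex_minnP exP.
have {}min_c g : H g -> g <> 1 -> L c <= L g.
  by move=> Hg g1; rewrite Lc; apply: min_c; apply/asboolP; exists g.
have gen g : H g -> exists n : int, g = zpow c n.
  have [m] := ubnP (L g); elim: m g => // m IH g; rewrite ltnS => Lg Hg.
  have [->|/eqP g1] := eqVneq g 1; first by exists 0%R.
  have c0 : 0 < L c by rewrite lt0n; apply/eqP => /L0.
  have cg := min_c g Hg g1.
  pose i := (L g).+1.
  have Lgi : L g < i by []. have Lci : L c < i by [].
  have LVci : L c^-1 < i by rewrite LV.
  have cu := HC c Hc; have gu := HC g Hg; have Vcu := HC _ (HV c Hc).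
  have lenVc : L (u ^+ i * c^-1) = L (u ^- i * c).
    by rewrite -LV invgM invgK; congr L; apply/commuteV/commuteX.
  have [] : L (c^-1 * g) < L g \/ L (c * g) < L g.
    have axc := centralizer_axis axu cu Lci.
    have lc := centralizer_length axu cu Lci.
    have lg := centralizer_length axu gu Lgi.
    have cg1 := centralizer_dist axu cu gu Lci Lgi.
    have gc1 := centralizer_dist axu gu cu Lgi Lci.
    have cg2 := centralizer_dist axu Vcu gu LVci Lgi.
    have gc2 := centralizer_dist axu gu Vcu Lgi LVci.
    have gc1V : L (g^-1 * c) = L (c^-1 * g) by rewrite -LV invgM invgK.
    have gc2V : L (g^-1 * c^-1) = L (c * g) by rewrite -LV invgM !invgK.
    have cVK : L (c^-1^-1 * g) = L (c * g) by rewrite invgK.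
    rewrite cVK lenVc in cg2; rewrite lenVc gc2V in gc2.
    rewrite gc1V in gc1; lia.
  - move=> lt_cg; have [n gE] := IH _ (leq_trans lt_cg Lg) (HM _ _ (HV _ Hc) Hg).
    by exists (1 + n)%R; rewrite zpowD -gE mulVKg.
  - move=> lt_cg; have [n gE] := IH _ (leq_trans lt_cg Lg) (HM _ _ Hc Hg).
    by exists (- 1 + n)%R; rewrite zpowD -gE mulKg.
exists c => //; split=> // n cn1; have [//|n0] := eqVneq n 0%R.
(* As [u] is a power of [c], a relation c^n = 1 would give u^n = 1. *)
have [m um] := gen u Hu; have : zpow u n = 1.
  by rewrite um zpowM_exp GRing.mulrC -zpowM_exp cn1; case: (m) => j;
    rewrite /= expg1n ?invg1.
move/(congr1 L); rewrite tree_length_zpow // L1 => /eqP.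
by rewrite muln_eq0 absz_eq0 (negPf n0) eqn0Ngt u0.
Qed.


(** * Stabilizers of axes *)

Lemma axis_stabJ u f : axis_stab u f <-> u ^ f = u \/ u ^ f = u^-1.
Proof.
have invE : f * u = u^-1 * f <-> u * f = f * u^-1.
  split=> [fu|uf]; first by apply: (mulIg u); rewrite mulgVK -mulA fu mulVKg.
  by apply: (mulgI u); rewrite mulVKg mulA uf mulgVK.
rewrite /axis_stab invE; split=> -[e|e].
- by left; rewrite conjgE -e mulKg.
- by right; rewrite conjgE e mulKg.
- by left; rewrite [RHS]conjgC e.
- by right; rewrite [LHS]conjgC e.
Qed.

Lemma axis_stabV u f : axis_stab u f -> axis_stab u f^-1.
Proof.
rewrite !axis_stabJ => -[uf|uf]; [left|right].
  by rewrite -{1}uf conjgK.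
by apply: invg_inj; rewrite -conjVg -uf conjgK uf invgK.
Qed.

Lemma axis_stabM u f g : axis_stab u f -> axis_stab u g -> axis_stab u (f * g).
Proof.
rewrite !axis_stabJ conjgM => -[] -> [] E; rewrite ?conjVg E ?invgK; auto.
Qed.

Lemma axis_stabX u f n : axis_stab u f -> axis_stab u (f ^+ n).
Proof.
move=> uf; elim: n => [|n IH]; first by left; rewrite mulg1 mul1g.
by rewrite expgS; apply: axis_stabM.
Qed.

Lemma axis_stab_zpow u f (n : int) : axis_stab u f -> axis_stab u (zpow f n).
Proof.
move=> uf; case: n => n; last apply: axis_stabV; exact: axis_stabX.
Qed.

(** Preservation of the axis is turned into an equation, to be refuted by ping-pong. *)
Lemma axis_stab_eq u f n : axis_stab u f ->
  exists2 e : int, e = 1%R \/ e = (- 1)%R &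
    f * u ^+ n * f^-1 * zpow (u ^+ n) e = 1.
Proof.
move=> /axis_stabV/axis_stabJ[] fu.
  exists (- 1)%R; [by right|]; rewrite zpowN zpow1.
  suff -> : f * u ^+ n * f^-1 = (u ^ f^-1) ^+ n by rewrite fu mulgV.
  by rewrite -conjXg conjgE invgK mulA.
exists 1%R; [by left|]; rewrite zpow1.
suff -> : f * u ^+ n * f^-1 = (u ^ f^-1) ^+ n by rewrite fu expVgn mulVg.
by rewrite -conjXg conjgE invgK mulA.
Qed.

(** The equation of [axis_stab_eq] takes this shape for conjugates by g u^m; one bound covers both
    signs [e]. *)
Lemma tail_eval_rcons_neq u g (l : seq (G * int)) :
  axial u -> ~ axis_stab u g ->
  {in l, forall p : G * int, p.2 != 0%R /\ ~ axis_stab u p.1} ->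
  exists N0, forall N (n e : int), N0 < N -> n != 0%R ->
    e = 1%R \/ e = (- 1)%R ->
    g * (zpow (u ^+ N) n * tail_eval (u ^+ N) (rcons l (g^-1, e))) <> 1.
Proof.
move=> axu ug lP.
have lP' (e : int) : e != 0%R ->
    {in rcons l (g^-1, e), forall p : G * int, p.2 != 0%R /\ ~ axis_stab u p.1}.
  move=> e0 p; rewrite mem_rcons inE => /orP[/eqP ->|/lP //].
  by split=> // /axis_stabV; rewrite invgK.
have [N1 N1P] := tail_eval_neq g^-1 axu (lP' 1%R isT).
have [N2 N2P] := tail_eval_neq g^-1 axu (lP' (- 1)%R isT).
exists (maxn N1 N2) => N n e; rewrite gtn_max => /andP[ltN1 ltN2] n0 eP /mulg1_eq.
by case: eP => ->; [move/esym/N1P|move/esym/N2P]; apply.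
Qed.

(* Otherwise [f] preserves the axes of the elements [u^(g u^m)], which leave
   every bounded region of the tree; this is impossible for elliptic [f], which
   fixes a single vertex, and for hyperbolic [f], which has a single axis. *)
Lemma axis_stab_escape u g f :
  axial u -> ~ axis_stab u g -> f <> 1 ->
  exists m0, forall m, m0 < m -> ~ axis_stab u (f ^ (g * u ^+ m)^-1).
Proof.
move=> axu ug f1; have [_ u0] := axu.
have nV x : ~ axis_stab u x -> ~ axis_stab u x^-1.
  by move=> ux /axis_stabV; rewrite invgK.
have [uf|uf] := pselect (axis_stab u f); last first.
  (* Let h = u^m and F = g h f h^-1 g^-1. Using the exponent m in [axis_stab_eq] as well makes F h
     F^-1 h^e = 1 an equation in h alone: g h f h^-1 g^-1 h g h f^-1 h^-1 g^-1 h^e = 1. *)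
  have [|m0 m0P] := @tail_eval_rcons_neq u g
    [:: (f, (- 1)%R); (g^-1, 1%R); (g, 1%R); (f^-1, (- 1)%R)] axu ug.
    by move=> p; rewrite !inE => /or4P[] /eqP -> /=; split=> //; apply: nV.
  exists m0 => m lt_m /(axis_stab_eq m)[e eP].
  move: (m0P m 1%R e lt_m isT eP); rewrite /tail_eval /= !big_cons big_nil /=.
  by rewrite !expg1 conjgE !gnorm => neq /neq.
case: uf => uf; last first.
  (* Here [f] inverts [u] and cannot serve as a coefficient; since F = g h^2 f g^-1, it is absorbed
     into f g^-1 and g f^-1. *)
  have gfV : ~ axis_stab u (g / f).
    move=> ugf; apply: ug; rewrite -[g](mulgVK f).
    by apply: axis_stabM => //; right.
  have [|m0 m0P] := @tail_eval_rcons_neq u g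
    [:: (f / g, 1%R); (g / f, Negz 1)] axu ug.
    move=> p; rewrite !inE => /orP[] /eqP -> /=; split=> //.
    by rewrite -invgF; apply: nV.
  exists m0 => m lt_m /(axis_stab_eq m)[e eP].
  move: (m0P m (Posz 2) e lt_m isT eP); rewrite /tail_eval /= !big_cons big_nil /=.
  have fuX k : f * u ^+ k = u ^- k * f.
    elim: k => [|k IH]; first by rewrite invg1 mulg1 mul1g.
    by rewrite [in LHS]expgS (mulA f) uf -(mulA _ f) IH mulA -invgM -expgSr.
  have fum : f * u ^- m = u ^+ m * f.
    by apply: (mulIg (u ^+ m)); rewrite mulgVK -mulA fuX mulVKg.
  have -> : f ^ (g * u ^+ m)^-1 = g * u ^+ m ^+ 2 * f * g^-1.
    transitivity (g * (u ^+ m * (u ^+ m * f)) * g^-1); last first.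
      by rewrite expg2 !mulgA.
    by rewrite -fum conjgE !gnorm.
  by rewrite !expg1 !gnorm => neq /neq.
(* Here [f] commutes with [u]: both are powers of one [c], so that f^i = u^j with j <> 0. *)
have gT : subgroup [set: G] by exact: subgroup_closed.
have [c cu [gen inj]] := centralizer_cyclic axu (subgroup_centralizer u gT)
  (conj I erefl) (fun _ => @proj2 _ _).
have [j fE] := gen f (conj I uf); have [i uE] := gen u (conj I erefl).
have j0 : j != 0%R by apply/eqP => j0; apply: f1; rewrite fE j0.
have fuij : zpow f i = zpow u j by rewrite fE uE !zpowM_exp GRing.mulrC.
have [|m0 m0P] := @tail_eval_rcons_neq u g [:: (g^-1, 1%R); (g, (- j)%R)] axu ug.
  move=> p; rewrite !inE => /orP[] /eqP -> /=; split=> //; last by rewrite GRing.oppr_eq0.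
  exact: nV.
(* As [f] commutes with u^m, the conjugate does not depend on [m]; the large exponent [N] is chosen
   separately. *)
exists 0 => m _ uz; pose N := m0.+1.
have /(axis_stab_eq N)[e eP] : axis_stab u (zpow (f ^ g^-1) (N%:Z * i)%R).
  apply: axis_stab_zpow; suff <- : f ^ (g * u ^+ m)^-1 = f ^ g^-1 by [].
  rewrite invgM conjgM; congr (_ ^ _); apply/conjg_fixP/commgP.
  by apply/commuteV/commuteX.
have -> : zpow (f ^ g^-1) (N%:Z * i)%R = zpow (u ^+ N) j ^ g^-1.
  by rewrite zpowJ GRing.mulrC -zpowM_exp fuij zpowM_exp zpowX GRing.mulrC.
move: (m0P N j e (ltnSn _) j0 eP); rewrite /tail_eval /= !big_cons big_nil /=.
by rewrite !expg1 zpowN conjgE !gnorm => neq /neq.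
Qed.


(** * Subgroups that preserve an axis *)

(** The elements of [H] commuting with [u] form an infinite cyclic group generated by [c]. If they
    are not all of [H], some [r] in [H] inverts [u]; then [r] inverts [c] and r^2 = 1, which gives
    the dihedral group. *)
Lemma elementary_subgroup u (H : set G) :
  axial u -> subgroup H -> H u -> (forall g, H g -> axis_stab u g) ->
  isomorphic_to inf_cyclic H \/ isomorphic_to inf_dihedral H.
Proof.
move=> axu gH Hu HE; have [_ u0] := axu.
have Hzpow x (n : int) : H x -> H (zpow x n).
  by move=> Hx; case: n => k; last apply: (subgroupV gH); apply: (subgroupX gH).
have [c [Hc cu] [gen inj]] := centralizer_cyclic axu (subgroup_centralizer u gH)
  (conj Hu erefl) (fun _ => @proj2 _ _).
have injc : injective (zpow c).
  move=> m n mn; apply/eqP; rewrite -GRing.subr_eq0; apply/eqP/inj.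
  by rewrite zpowD zpowN mn mulgV.
have [HC|] := pselect (forall g, H g -> commute g u).
  left; exists (zpow c); split=> //; apply/seteqP; split=> [_ [n _ <-]|g Hg].
    exact: Hzpow.
  by have [n ->] := gen g (conj Hg (HC g Hg)); exists n.
move=> /existsNP[r /not_implyP[Hr nru]]; right.
have ru : u ^ r = u^-1.
  by case/axis_stabJ: (HE r Hr) => // ur; case: nru; rewrite /commute [RHS]conjgC ur.
have [i uE] := gen u (conj Hu erefl).
have i0 : i != 0%R by apply/eqP => i0; rewrite uE i0 L1 in u0.
have cr : c ^ r = c^-1.
  have [|n crE] := gen (c ^ r).
    split; first by rewrite conjgE; do !apply: subgroupM => //; apply: subgroupV.
    suff : commute (c ^ r) (u ^ r) by rewrite ru => /commuteV; rewrite invgK.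
    by rewrite /commute -!conjMg cu.
  have /injc/eqP : zpow c (n * i)%R = zpow c (- i)%R.
    by rewrite -zpowM_exp -crE zpowJ -uE ru uE zpowN.
  rewrite -GRing.mulN1r; move/eqP/(GRing.mulIf i0) => n1.
  by rewrite crE n1 zpowN zpow1.
have zcr (n : int) : r * zpow c n = zpow c (- n)%R * r.
  rewrite [RHS]conjgC -zpowJ cr; congr (_ * _).
  by rewrite -[c^-1]/(zpow c (- 1)%R) zpowM_exp GRing.mulrNN GRing.mul1r.
(* This power of [c] is both centralized and inverted by [r]. *)
have rr : r * r = 1.
  have [|k rrE] := gen (r * r).
    split; first exact: subgroupM.
    by rewrite /commute [RHS]conjgC conjgM ru conjVg ru invgK.
  have := zcr k; rewrite -rrE mulgA => /mulIg; rewrite rrE => /injc kN.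
  by have -> : k = 0%R by lia.
pose f (x : inf_dihedral) := zpow c x.1 * (if x.2 then r else 1).
have fM : {morph f : x y / x * y}.
  move=> [m s] [n t]; rewrite /f.
  have -> : ((m, s) : inf_dihedral) * (n, t) =
    ((m + (-1) ^+ s * n)%R, s (+) t) by [].
  rewrite /= zpowD; case: s.
    rewrite GRing.expr1 GRing.mulN1r -!mulA (mulA r) zcr.
    by case: t; rewrite /= ?mulg1 -?mulA ?rr ?mulg1.
  by rewrite GRing.expr0 GRing.mul1r mulg1 mulA.
pose F : {multiplicative inf_dihedral -> G} :=
  HB.pack f (isMultiplicative.Build inf_dihedral G f fM).
exists F; split.
  have kerf (w : inf_dihedral) : f w = 1 -> w = 1.
    case: w => n []; rewrite /f /=; last by rewrite mulg1 => /inj ->.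
    by move=> /mulg1_eq rE; case: nru; rewrite -rE uE -zpowN /commute zpowC.
  move=> v w vw; have fvw : f v = f w by exact: vw.
  suff /kerf/divg1_eq : f (v / w) = 1 by [].
  by rewrite fM fvw -fM mulgV /f mulg1.
apply/seteqP; split=> [_ [[n s] _ <-]|g Hg].
  by apply: subgroupM => //; [exact: Hzpow|case: s => //; exact: subgroup1].
have [gu|gu] := pselect (commute g u).
  by have [n ->] := gen g (conj Hg gu); exists (n, false); rewrite //= /f mulg1.
have ug : u ^ g = u^-1.
  by case/axis_stabJ: (HE g Hg) => // ug; case: gu; rewrite /commute [RHS]conjgC ug.
have [|n gE] := gen (g * r^-1).
  split; first by apply: subgroupM => //; exact: subgroupV.
  by rewrite /commute [RHS]conjgC conjgM ug -ru conjgK.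
by exists (n, true); rewrite //= /f -gE mulgVK.
Qed.

(** * Generic elements of the other subgroups *)

(** Take y = (g u^m)^-1 with [g] moving the axis and [m] beyond the bounds of [axis_stab_escape] for
    all of [F]. *)
Lemma generic_conjugate u (H : set G) (F : seq G) :
  axial u -> subgroup H -> H u -> ~ (forall g, H g -> axis_stab u g) ->
  {in F, forall f, f <> 1} ->
  exists2 y, H y & {in F, forall f, ~ axis_stab u (f ^ y)}.
Proof.
move=> axu gH Hu /existsNP[g /not_implyP[Hg ug]] F1.
have [m0 m0P] : exists m0, {in F, forall f, forall m, m0 < m ->
    ~ axis_stab u (f ^ (g * u ^+ m)^-1)}.
  elim: F F1 => [_|f F IH F1]; first by exists 0.
  have [|m1 m1P] := IH.
    by move=> h hF; have := F1 h; rewrite inE hF orbT; exact.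
  have [m2 m2P] := axis_stab_escape axu ug (F1 f (mem_head _ _)).
  exists (maxn m1 m2) => h; rewrite inE => /orP[/eqP ->|hF] m;
    rewrite gtn_max => /andP[lt1 lt2]; [exact: m2P|exact: m1P].
exists (g * u ^+ m0.+1)^-1 => [|f fF]; last exact: m0P.
by apply: (subgroupV gH); apply: (subgroupM gH) => //; apply: (subgroupX gH).
Qed.


Lemma tail_evalJ h (n : int) (l : seq (G * int)) t :
  zpow (h ^ t) n * tail_eval (h ^ t) l =
  (zpow h n * tail_eval h [seq (p.1 ^ t^-1, p.2) | p <- l]) ^ t.
Proof.
rewrite conjMg zpowJ /tail_eval big_map conjg_prod; congr (_ * _).
by apply: eq_bigr => p _; rewrite conjMg zpowJ conjgKV.
Qed.

(** A triple (n, l, c) in [W] encodes an equation x^n g1 x^n1 ... gk x^nk = c. Conjugation by one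
    [z] moves all coefficients out of [axis_stab u]; a conjugate of a large power of [u] then avoids
    all the equations. *)
Lemma nonelementary_generic u (H : set G) (W : seq (int * seq (G * int) * G)) :
  axial u -> subgroup H -> H u -> ~ (forall g, H g -> axis_stab u g) ->
  {in W, forall e, e.1.1 != 0%R /\
    {in e.1.2, forall p : G * int, p.1 <> 1 /\ p.2 != 0%R}} ->
  exists2 h, H h &
    {in W, forall e, zpow h e.1.1 * tail_eval h e.1.2 <> e.2}.
Proof.
move=> axu gH Hu nE WP.
have [|z Hz zP] := @generic_conjugate u H
    (flatten [seq [seq p.1 | p : G * int <- e.1.2] | e <- W]) axu gH Hu nE.
  by move=> f /flatten_mapP[e /WP[_ eP]] /mapP[p /eP[p1 _] ->].
have [N0 N0P] : exists N0, {in W, forall e, forall N, N0 < N ->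
    zpow ((u ^+ N) ^ z^-1) e.1.1 * tail_eval ((u ^+ N) ^ z^-1) e.1.2 <> e.2}.
  elim: W WP zP => [_ _|[[n l] c] W IH WP zP]; first by exists 0.
  have [||N1 N1P] := IH.
  - by move=> e eW; apply: WP; rewrite inE eW orbT.
  - by move=> f fW; apply: zP; rewrite /= mem_cat fW orbT.
  have [/= n0 lP] := WP _ (mem_head _ _).
  have [|N2 N2P] := @tail_eval_neq u [seq (p.1 ^ z, p.2) | p <- l] (c ^ z) axu.
    move=> _ /mapP[p pl ->] /=; split; first by have [] := lP p pl.
    by apply: zP; rewrite /= mem_cat (map_f (fun p : G * int => p.1)).
  exists (maxn N1 N2) => e; rewrite inE => /orP[/eqP ->|eW] N;
    rewrite gtn_max => /andP[lt1 lt2]; last exact: N1P.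
  by rewrite tail_evalJ invgK /= => /(canRL (conjgKV _)); apply: N2P.
exists ((u ^+ N0.+1) ^ z^-1) => [|e eW]; last exact: N0P.
rewrite conjgE invgK; do !apply: (subgroupM gH) => //; first exact: subgroupX.
exact: (subgroupV gH).
Qed.

End TreeLength.

(** * Normal forms in free products *)

Section NormalForm.
Variables A B : groupType.
Local Notation letter := (A + B)%type.
Local Notation G := (free_product A B : groupType).
Implicit Types (l h : letter) (s t r : seq letter) (x y z g : G).

Definition side l : bool := if l is inl _ then true else false.

Definition unit_letter l : bool :=
  match l with inl a => a == 1 | inr b => b == 1 end.

(* Letters on different sides are not multiplied; the value is then junk. *)
Definition mul_letter l h : letter :=
  match l, h with
  | inl a, inl a' => inl (a * a')
  | inr b, inr b' => inr (b * b')
  | _, _ => l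
  end.

Definition alternating (bs : seq bool) : bool := sorted (fun a b => a != b) bs.

Definition reduced s : bool :=
  all (predC unit_letter) s && alternating (map side s).

(** Left multiplication of a reduced word by a letter. As in van der Waerden's argument, this action
    proves that normal forms are unique. *)
Definition push l s : seq letter :=
  if unit_letter l then s
  else if s is h :: s' then
    if side l == side h then
      if unit_letter (mul_letter l h) then s' else mul_letter l h :: s'
    else l :: s
  else [:: l].

Lemma side_mul l h : side l = side h -> side (mul_letter l h) = side l.
Proof. by case: l h => [a|b] [a'|b']. Qed.

Lemma reduced_cons l s :
  reduced (l :: s) = [&& ~~ unit_letter l, reduced s &
                        if s is h :: _ then side l != side h else true].
Proof.
rewrite /reduced /alternating /=; case: s => [|h s] /=; rewrite ?andbT //.
by rewrite -!andbA; do !bool_congr.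
Qed.

Lemma push_id l s : reduced (l :: s) -> push l s = l :: s.
Proof.
rewrite reduced_cons /push => /and3P[/negPf -> _].
by case: s => // h s /negPf ->.
Qed.

Lemma push_reduced l s : reduced s -> reduced (push l s).
Proof.
rewrite /push; case: ifPn => // l1; case: s => [|h s] red_s.
  by rewrite reduced_cons l1.
case: eqP => [lh|/eqP lh]; last by rewrite reduced_cons l1 red_s lh.
have := red_s; rewrite reduced_cons => /and3P[_ red_s' hs].
case: ifPn => // lh1; rewrite reduced_cons lh1 red_s' /=.
by case: s hs {red_s red_s'} => // k s; rewrite side_mul // lh.
Qed.

Lemma mul_unitl l h : side l = side h -> unit_letter l -> mul_letter l h = h.
Proof. by case: l h => [a|b] [a'|b'] //= _ /eqP ->; rewrite mul1g. Qed.

Lemma mul_unitr l h : side l = side h -> unit_letter h -> mul_letter l h = l.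
Proof. by case: l h => [a|b] [a'|b'] //= _ /eqP ->; rewrite mulg1. Qed.

Lemma mul_letterA l h k : side l = side h -> side h = side k ->
  mul_letter l (mul_letter h k) = mul_letter (mul_letter l h) k.
Proof. by case: l h k => [a|b] [a'|b'] [c|c] //= _ _; rewrite mulgA. Qed.

Lemma side_inv l : side (fp_inv_letter l) = side l.
Proof. by case: l. Qed.

Lemma unit_inv l : unit_letter (fp_inv_letter l) = unit_letter l.
Proof. by case: l => c /=; rewrite invg_eq1. Qed.

Lemma unit_mulV l h : side l = side h ->
  unit_letter (mul_letter (fp_inv_letter l) h) = (l == h).
Proof.
case: l h => [a|b] [a'|b'] //= _.
  by rewrite mulg_eq1 eqg_inv.
by rewrite mulg_eq1 eqg_inv.
Qed.

(** With unit letters allowed, every reduced word can be written as [cons_nonunit k t] with [k] on a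
    prescribed side; this unifies the cases of [push]. *)
Definition cons_nonunit l s : seq letter := if unit_letter l then s else l :: s.

Definition off_side (b : bool) s : bool := if s is h :: _ then b != side h else true.

Lemma push_cons_nonunit l k t : side l = side k -> off_side (side l) t ->
  push l (cons_nonunit k t) = cons_nonunit (mul_letter l k) t.
Proof.
move=> lk lt; rewrite /cons_nonunit /push; case: (boolP (unit_letter l)) => l1.
  by rewrite mul_unitl.
case: ifPn => k1; last by rewrite lk eqxx.
rewrite mul_unitr // (negPf l1).
by case: t lt => //= h t /negPf ->.
Qed.

Lemma reduced_split l s : reduced s -> exists k t,
  [/\ side k = side l, off_side (side l) t & s = cons_nonunit k t].
Proof.
move=> red_s; rewrite /cons_nonunit.
have [off|] := boolP (off_side (side l) s).
  (* The leading letter is the unit on the side of [l]. *)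
  exists (mul_letter (fp_inv_letter l) l), s.
  by rewrite side_mul ?side_inv ?unit_mulV ?eqxx.
case: s red_s => //= h s; rewrite negbK => + /eqP lh.
by rewrite reduced_cons lh => /and3P[/negPf h1 _ hs]; exists h, s; rewrite h1.
Qed.

(** Once a letter [k] on the side of [l] is split off, this is associativity for [l], [h], [k]. *)
Lemma push_mul l h s : reduced s -> side l = side h ->
  push l (push h s) = push (mul_letter l h) s.
Proof.
move=> red_s lh; have [k [t [kl lt ->]]] := reduced_split l red_s.
rewrite !push_cons_nonunit ?side_mul ?mul_letterA ?kl ?lh //.
all: by rewrite -?lh ?side_mul -?lh.
Qed.

Definition run s t : seq letter := foldr push t s.

Lemma run_reduced s t : reduced t -> reduced (run s t).
Proof. by move=> rt; elim: s => //= l s; apply: push_reduced. Qed.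

(** The action respects the defining relations; on the empty word, it gives equal elements the same
    normal form. *)
Lemma run_cong s s' : fp_cong s s' -> forall t, reduced t -> run s t = run s' t.
Proof.
rewrite /run; elim=> {s s'} //=.
- by move=> s s' _ IH t rt; rewrite IH.
- by move=> s s' s'' _ IH _ IH' t rt; rewrite IH ?IH'.
- by move=> s s' t t' _ IHs _ IHt r rr; rewrite !foldr_cat IHt // IHs //; apply: run_reduced.
- by move=> a a' t rt; rewrite push_mul.
- by move=> b b' t rt; rewrite push_mul.
- by move=> t _; rewrite /push /= eqxx.
- by move=> t _; rewrite /push /= eqxx.
Qed.

Definition nf s : seq letter := run s [::].

Lemma nf_reduced s : reduced (nf s).
Proof. exact: run_reduced. Qed.

Lemma nf_id s : reduced s -> nf s = s.
Proof.
elim: s => //= l s IH rls; move: (rls); rewrite reduced_cons => /and3P[_ rs _].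
by rewrite /nf /= -/(nf s) IH // push_id.
Qed.

Lemma fp_word_cons l s : fp_word (l :: s) = fp_word [:: l] * fp_word s.
Proof. by rewrite -cat1s [RHS]fp_mulE. Qed.

Lemma fp_word_cat s t : fp_word (s ++ t) = fp_word s * fp_word t.
Proof. by rewrite [RHS]fp_mulE. Qed.

Lemma fp_inl1 : fp_inl B 1 = 1 :> G.
Proof. exact/fp_wordP/fp_onel. Qed.

Lemma fp_inr1 : fp_inr A 1 = 1 :> G.
Proof. exact/fp_wordP/fp_oner. Qed.

Lemma fp_word_unit l : unit_letter l -> fp_word [:: l] = 1.
Proof.
by case: l => c /= /eqP ->; [exact: fp_inl1|exact: fp_inr1].
Qed.

Lemma fp_word_mul l h : side l = side h ->
  fp_word [:: mul_letter l h] = fp_word [:: l] * fp_word [:: h].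
Proof.
rewrite -fp_word_cat; case: l h => [a|b] [a'|b'] //= _; apply/fp_wordP/fp_sym.
  exact: fp_mull.
exact: fp_mulr.
Qed.

Lemma fp_word_push l s : fp_word (push l s) = fp_word (l :: s).
Proof.
rewrite fp_word_cons /push; case: ifPn => [l1|l1].
  by rewrite fp_word_unit // mul1g.
case: s => [|h s]; first by rewrite -fp_word_cat.
case: eqP => [lh|_]; last by rewrite -fp_word_cons.
rewrite (fp_word_cons h) mulgA -fp_word_mul //.
by case: ifPn => m1; [rewrite fp_word_unit // mul1g|rewrite -fp_word_cons].
Qed.

Lemma fp_word_nf s : fp_word (nf s) = fp_word s.
Proof.
elim: s => //= l s IH; rewrite /nf /= -/(nf s) fp_word_push fp_word_cons IH.
by rewrite -fp_word_cons.
Qed.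

Lemma fp_wordE s t : fp_word s = fp_word t -> nf s = nf t.
Proof. by move=> /fp_wordP/run_cong; apply. Qed.

Definition normal_form x : seq letter := nf (fp_repr x).

Lemma normal_form_reduced x : reduced (normal_form x).
Proof. exact: nf_reduced. Qed.

Lemma normal_formK x : fp_word (normal_form x) = x.
Proof. by rewrite fp_word_nf fp_reprK. Qed.

Lemma normal_form_word s : normal_form (fp_word s) = nf s.
Proof. by apply: fp_wordE; rewrite fp_reprK. Qed.

Definition syllables x : nat := size (normal_form x).

Lemma syllables_word s : reduced s -> syllables (fp_word s) = size s.
Proof. by move=> rs; rewrite /syllables normal_form_word nf_id. Qed.

Lemma syllables_le s : syllables (fp_word s) <= size s.
Proof.
rewrite /syllables normal_form_word; elim: s => //= l s IH.
rewrite /nf /= -/(nf s); apply: leq_trans (_ : (size (nf s)).+1 <= _) => //.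
rewrite /push; case: ifP => // _; case: (nf s) => // h t.
by case: eqP => // _; case: ifP => //= _; apply: leqW.
Qed.


(** * Syllable length as a tree length *)

Lemma fp_word_inv s : (fp_word s)^-1 = fp_word (fp_inv_word s).
Proof. exact: fp_invE. Qed.

Lemma sides_inv s : map side (fp_inv_word s) = rev (map side s).
Proof.
by rewrite /fp_inv_word map_rev -map_comp; congr rev; apply: eq_map; exact: side_inv.
Qed.

Lemma alternating_rev bs : alternating (rev bs) = alternating bs.
Proof.
rewrite /alternating rev_sorted; case: bs => //= b bs.
by apply: eq_path => c d; rewrite eq_sym.
Qed.

Lemma nonunit_inv s :
  all (predC unit_letter) (fp_inv_word s) = all (predC unit_letter) s.
Proof.
rewrite /fp_inv_word all_rev all_map; apply: eq_all => l /=.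
by rewrite unit_inv.
Qed.

Lemma reduced_inv s : reduced (fp_inv_word s) = reduced s.
Proof. by rewrite /reduced sides_inv alternating_rev nonunit_inv. Qed.

Lemma reduced_cat_cons s l t :
  reduced (s ++ l :: t) = reduced (rcons s l) && reduced (l :: t).
Proof.
rewrite /reduced !map_cat /alternating sorted_cat_cons map_rcons all_cat all_rcons.
by rewrite /=; case: (unit_letter l); case: (all _ s); case: (all _ t) => //=;
  rewrite ?andbF.
Qed.

Lemma reduced_rcons_side s l h :
  side l = side h -> unit_letter l = unit_letter h ->
  reduced (rcons s l) = reduced (rcons s h).
Proof.
by move=> lh lh1; rewrite /reduced !map_rcons !all_rcons lh /= lh1.
Qed.

Lemma reduced_cons_side s l h :
  side l = side h -> unit_letter l = unit_letter h ->
  reduced (l :: s) = reduced (h :: s).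
Proof. by move=> lh lh1; rewrite !reduced_cons lh lh1. Qed.

Lemma inv_word_cons l s :
  fp_inv_word (l :: s) = rcons (fp_inv_word s) (fp_inv_letter l).
Proof. by rewrite /fp_inv_word /= rev_cons. Qed.

Lemma size_inv s : size (fp_inv_word s) = size s.
Proof. by rewrite size_rev size_map. Qed.

(* Twice the length of the common initial segment of the geodesics that start
   at the base point and have labels [s] and [t]: two distinct letters on one
   side share a half-edge. *)
Fixpoint overlap s t : nat :=
  match s, t with
  | l :: s', h :: t' => if l == h then (overlap s' t').+2 else side l == side h
  | _, _ => 0
  end.

(** An ultrametric inequality: [s] and [r] agree at least as far as both agree with [t]. *)
Lemma overlap_min s t r : minn (overlap s t) (overlap t r) <= overlap s r.
Proof.
elim: s t r => [|l s IH] [|h t] [|k r] //=; rewrite ?minn0 ?min0n //.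
have [lh|lh] := eqVneq l h; have [hk|hk] := eqVneq h k.
- by rewrite lh hk eqxx; have := IH t r; lia.
- by rewrite lh (negPf hk); case: (side h == side k); lia.
- by rewrite -hk (negPf lh); case: (side l == side h); lia.
- case: ifP => // _; first lia.
  by case: (side l) (side h) (side k) => [] [] [].
Qed.

(** Each common initial letter cancels and costs two; the first distinct letters, if on one side,
    merge and cost one. *)
Lemma syllables_invM s t : reduced s -> reduced t ->
  syllables ((fp_word s)^-1 * fp_word t) + overlap s t = size s + size t.
Proof.
rewrite fp_word_inv -fp_word_cat.
elim: s t => [|l s IH] [|h t] rs rt.
- by rewrite syllables_word.
- by rewrite syllables_word //= addn0.
- by rewrite cats0 syllables_word ?reduced_inv // size_inv /= addn0.
have [rs' rt'] : reduced s /\ reduced t.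
  by move: rs rt; rewrite !reduced_cons => /and3P[_ -> _] /and3P[_ -> _].
have l1 : ~~ unit_letter l by move: rs; rewrite reduced_cons => /and3P[].
have h1 : ~~ unit_letter h by move: rt; rewrite reduced_cons => /and3P[].
rewrite inv_word_cons cat_rcons /=.
have rls : reduced (rcons (fp_inv_word s) (fp_inv_letter l)).
  by rewrite -inv_word_cons reduced_inv.
have [lh|lh] := eqVneq (side l) (side h); last first.
  have -> : (l == h) = false by apply/eqP => e; rewrite e eqxx in lh.
  rewrite syllables_word; last first.
    by rewrite reduced_cat_cons rls reduced_cons rt unit_inv l1 side_inv.
  by rewrite size_cat /= size_inv ?(negPf lh); lia.
have -> : fp_word (fp_inv_word s ++ [:: fp_inv_letter l, h & t]) =
  fp_word (fp_inv_word s ++ mul_letter (fp_inv_letter l) h :: t).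
  rewrite !fp_word_cat (fp_word_cons (fp_inv_letter l)) (fp_word_cons h).
  by rewrite (fp_word_cons (mul_letter _ _)) fp_word_mul ?side_inv // -!mulgA.
have m1 := unit_mulV lh; case: eqP m1 => [_|_] m1.
  rewrite fp_word_cat fp_word_cons fp_word_unit // mul1g -fp_word_cat.
  have := IH t rs' rt'; rewrite /=; lia.
rewrite syllables_word; first by rewrite size_cat /= size_inv; lia.
rewrite reduced_cat_cons (reduced_cons_side _ (h := h)).
- by rewrite rt (reduced_rcons_side _ (h := fp_inv_letter l)) ?rls // ?side_mul
    ?side_inv // m1 unit_inv (negPf l1).
- by rewrite side_mul ?side_inv.
- by rewrite m1 (negPf h1).
Qed.

(** [overlap] is twice the Gromov product, so [overlap_min] is the four-point condition. *)
Lemma syllables_tree : tree_length syllables.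
Proof.
have distE x y : syllables (x^-1 * y) + overlap (normal_form x) (normal_form y) =
    syllables x + syllables y.
  rewrite -{1}[x]normal_formK -{1}[y]normal_formK.
  by rewrite syllables_invM ?normal_form_reduced.
split=> [x|x|x y z].
- split=> [/size0nil x0|->]; first by rewrite -[x]normal_formK x0.
  by rewrite -[1]/(fp_word [::]) syllables_word.
- have rx := normal_form_reduced x; rewrite -[x]normal_formK fp_word_inv.
  by rewrite !syllables_word ?size_inv // reduced_inv.
- have := overlap_min (normal_form x) (normal_form y) (normal_form z).
  have := distE x y; have := distE y z; have := distE x z; lia.
Qed.

(** * Cyclic reduction and subgroups without hyperbolic elements *)

(** The word is cyclically reduced: its square is reduced as written. *)
Lemma axial_word l s : reduced (l :: s) -> side l != side (last l s) ->
  axial (@syllables) (fp_word (l :: s)).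
Proof.
move=> rls ls; split; last by rewrite syllables_word.
rewrite expg2 -fp_word_cat !syllables_word //; first by rewrite size_cat; lia.
rewrite reduced_cat_cons rls andbT.
move: (rls); rewrite /reduced /alternating map_rcons all_rcons /=.
move=> /andP[/andP[-> ->] sl] /=; rewrite rcons_path sl /= last_map eq_sym.
exact: ls.
Qed.


Lemma reduced_rcons_alternating l h s e :
  reduced (l :: h :: rcons s e) -> side e != side (last h s).
Proof.
rewrite /reduced /alternating /= map_rcons rcons_path last_map.
by case/and4P => _ _ _; rewrite eq_sym.
Qed.

(** Cyclic reduction: if the first and last letters are on one side, conjugating by the first merges
    them and shortens the word. *)
Lemma conj_axial_or_letter x : exists y,
  (exists l, x ^ y = fp_word [:: l]) \/ axial (@syllables) (x ^ y).
Proof.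
have [n] := ubnP (syllables x); elim: n x => // n IH x; rewrite ltnS => xn.
have := normal_form_reduced x; have := normal_formK x; move: xn.
rewrite /syllables; case: (normal_form x) => [|l s] xn xE rx.
  exists 1; left; exists (inl 1); rewrite conjg1 -xE fp_word_unit //=.
have [ls|] := boolP (side l != side (last l s)).
  by exists 1; right; rewrite conjg1 -xE; apply: axial_word.
rewrite negbK => /eqP; case/lastP: s xn xE rx => [|s h] xn xE rx.
  by exists 1; left; exists l; rewrite conjg1.
rewrite last_rcons => lh.
have xlE : x ^ fp_word [:: l] = fp_word (rcons s (mul_letter h l)).
  rewrite conjgE -xE (fp_word_cons l (rcons s h)) -!cats1 !fp_word_cat fp_word_mul //.
  by rewrite !mulgA mulVg mul1g.
have [|y yP] := IH (x ^ fp_word [:: l]).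
  rewrite xlE; apply: leq_ltn_trans (syllables_le _) _.
  by move: xn; rewrite /= !size_rcons.
by exists (fp_word [:: l] * y); rewrite conjgM.
Qed.

(* [a] and an elliptic [g] on another side fix distinct vertices, so that
   their product is hyperbolic. *)
Lemma elliptic_same_side (H : set G) l g :
  subgroup H -> (forall x y, H x -> ~ axial (@syllables) (x ^ y)) ->
  H (fp_word [:: l]) -> ~~ unit_letter l -> H g ->
  exists2 h, side h = side l & g = fp_word [:: h].
Proof.
move=> gH noax Hl l1 Hg; pose a : G := fp_word [:: l].
have Hag : H (a * g) by apply: (subgroupM gH).
have noax_word x y h s : H x -> x ^ y = fp_word (h :: s) -> reduced (h :: s) ->
    side h = side (last h s).
  move=> Hx xy rs; apply/eqP; apply/negPn/negP => hs.
  by apply: (noax x y Hx); rewrite xy; apply: axial_word.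
have := normal_form_reduced g; have := normal_formK g.
case: (normal_form g) => [|h t] gE rg.
  exists (mul_letter (fp_inv_letter l) l); first by rewrite side_mul side_inv.
  by rewrite -gE fp_word_unit // unit_mulV ?eqxx.
(* If [g] begins on the other side, it also ends there, or it would be hyperbolic; then [a * g]
   begins and ends on different sides. *)
have [hl|hl] := eqVneq (side h) (side l); last first.
  have := noax_word g 1 h t Hg; rewrite conjg1 gE => /(_ erefl rg) ht.
  have := noax_word (a * g) 1 l (h :: t) Hag.
  rewrite conjg1 -gE -fp_word_cons => /(_ erefl) /= lt.
  have {}lt : side l = side (last h t).
    by apply: lt; rewrite reduced_cons l1 rg eq_sym hl.
  by rewrite ht -lt eqxx in hl.
case: t gE rg => [|k t] gE rg; first by exists h.
have [h1 rkt hk] : [/\ ~~ unit_letter h, reduced (k :: t) & side h != side k].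
  by apply/and3P; rewrite -reduced_cons.
pose y : G := fp_word [:: h].
have gy : g ^ y = fp_word (rcons (k :: t) h).
  by rewrite conjgE -gE (fp_word_cons h (k :: t)) -cats1 fp_word_cat !mulgA mulVg mul1g.
(* Unless [g] ends on the side of [h], its conjugate by [h] is cyclically reduced. *)
have [hlast|hlast] := eqVneq (side h) (side (last k t)); last first.
  have := noax_word g y k (rcons t h) Hg gy.
  rewrite last_rcons => kh; have {}kh : side k = side h; last first.
    by rewrite kh eqxx in hk.
  apply: kh; move: rkt h1 hlast; rewrite /reduced /alternating /= all_rcons map_rcons rcons_path /=.
  by rewrite last_map [_ == side (last k t)]eq_sym => /andP[/andP[-> ->] ->] -> ->.
case/lastP: t gE rg rkt gy hlast => [|t e] gE rg rkt gy hlast.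
  by rewrite hlast eqxx in hk.
rewrite last_rcons in hlast.
have kt : side e != side (last k t) := reduced_rcons_alternating rg.
have rk : reduced (k :: t).
  move: rkt; rewrite /reduced /alternating /= map_rcons all_rcons rcons_path.
  by move=> /andP[/and3P[-> _ ->] /andP[->]].
have gyE : g ^ y = fp_word (rcons (k :: t) (mul_letter e h)).
  rewrite gy -!cats1 /= -catA -cat_cons -[in RHS]cat_cons !fp_word_cat.
  by rewrite fp_word_mul // -fp_word_cat.
(* The same holds unless the last letter [e] is the inverse of [h]. *)
have [eh1|eh1] := boolP (unit_letter (mul_letter e h)); last first.
  have := noax_word g y k (rcons t (mul_letter e h)) Hg gyE.
  rewrite last_rcons side_mul // => keh; have {}keh : side k = side e; last first.
    by rewrite hlast -keh eqxx in hk.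
  apply: keh; rewrite -rcons_cons (reduced_rcons_side _ (h := e)) ?side_mul //.
  move: rkt; rewrite /reduced /= all_rcons => /andP[/and3P[_ e1 _] _].
  by rewrite (negPf eh1) (negPf e1).
(* Now g = h (k t) h^-1, and the conjugate of [a * g] by [h] begins with m = h^-1 l h and ends on
   the other side. *)
pose m := mul_letter (fp_inv_letter h) (mul_letter l h).
have lhm : side (mul_letter l h) = side h by rewrite side_mul.
have sm : side m = side h by rewrite side_mul ?side_inv.
have m1 : ~~ unit_letter m.
  rewrite unit_mulV ?lhm //; apply: contra l1 => /eqP.
  by move: hl; clear; case: l h => [a|b] [c|c] //= _ [/esym/eqP];
    rewrite -{2}[c]mul1g (inj_eq (mulIg c)).
have agy : (a * g) ^ y = fp_word (m :: k :: t).
  rewrite conjMg gyE -cats1 fp_word_cat (fp_word_unit eh1) mulg1 (fp_word_cons m (k :: t)).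
  rewrite /m fp_word_mul ?side_inv // fp_word_mul //; congr (_ * _).
  by rewrite conjgE fp_word_inv.
have := noax_word (a * g) y m (k :: t) Hag agy.
rewrite /= => mkt; have {}mkt : side m = side (last k t).
  by apply: mkt; rewrite reduced_cons m1 rk sm hk.
by rewrite -hlast -sm mkt eqxx in kt.
Qed.


(** A non-trivial element of [H] is conjugate to a letter; [elliptic_same_side] then puts the whole
    conjugate of [H] in that factor. *)
Lemma elliptic_subgroup (H : set G) :
  subgroup H -> (forall x y, H x -> ~ axial (@syllables) (x ^ y)) ->
  exists g : G,
    (exists2 K : set A, subgroup K & [set h ^ g | h in H] = fp_inl B @` K) \/
    (exists2 K : set B, subgroup K & [set h ^ g | h in H] = fp_inr A @` K).
Proof.
move=> gH noax.
have [H1|] := pselect (forall x, H x -> x = 1).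
  exists 1; left; exists [set 1].
    by apply: subgroup_closed => [//|_ ->|_ _ -> ->]; rewrite ?invg1 ?mulg1.
  rewrite image_set1 fp_inl1; apply/seteqP; split=> [_ [x /H1 -> <-]|_ ->].
    by rewrite conjg1.
  by exists 1; [exact: subgroup1|rewrite conjg1].
move=> /existsNP[x /not_implyP[Hx x1]].
have [y [[l xyl]|]] := conj_axial_or_letter x; last by move/(noax x y Hx).
exists y; set Hy := [set h ^ y | h in H].
have gHy : subgroup Hy by exact: subgroup_conj.
have noaxy v z : Hy v -> ~ axial (@syllables) (v ^ z).
  by move=> [h Hh <-]; rewrite -conjgM; apply: noax.
have Hl : Hy (fp_word [:: l]) by exists x.
have l1 : ~~ unit_letter l.
  apply/negP => /fp_word_unit l1; apply: x1; apply/eqP.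
  by rewrite -(conjg_eq1 x y) xyl l1.
have same g : Hy g -> exists2 h, side h = side l & g = fp_word [:: h].
  exact: elliptic_same_side.
case: l {xyl Hl} l1 same => [a|b] _ same; [left|right].
  exists [set c | Hy (fp_inl B c)].
    apply: subgroup_closed => [|c|c e] /=.
    - by rewrite fp_inl1; apply: subgroup1.
    - rewrite -[fp_inl B c^-1]/(fp_word (fp_inv_word [:: inl c])) -fp_word_inv.
      exact: subgroupV.
    - by rewrite gmulfM; apply: subgroupM.
  apply/seteqP; split=> [g Hg|_ [c Hc <-]//].
  by have [[c|//] _ gE] := same g Hg; exists c => //=; rewrite -[fp_inl B c]gE.
exists [set c | Hy (fp_inr A c)].
  apply: subgroup_closed => [|c|c e] /=.
  - by rewrite fp_inr1; apply: subgroup1.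
  - rewrite -[fp_inr A c^-1]/(fp_word (fp_inv_word [:: inr c])) -fp_word_inv.
    exact: subgroupV.
  - by rewrite gmulfM; apply: subgroupM.
apply/seteqP; split=> [g Hg|_ [c Hc <-]//].
by have [[//|c] _ gE] := same g Hg; exists c => //=; rewrite -[fp_inr A c]gE.
Qed.

End NormalForm.

(** * Equations over a group *)

Section Equations.
Variable G : groupType.
Local Notation inl_x := (fp_inl inf_cyclic : G -> _).
Local Notation inr_x := (fp_inr G : inf_cyclic -> _).

Definition eqn_tail (l : seq (G * int)) : free_product G inf_cyclic :=
  \prod_(p <- l) (inl_x p.1 * inr_x p.2).

Definition eqn_tail_reduced (l : seq (G * int)) : Prop :=
  {in l, forall p : G * int, p.1 <> 1 /\ p.2 != 0%R}.

Lemma equation_form (w : free_product G inf_cyclic) :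
  (exists b, w = inl_x b) \/
  exists a (n : int) l b, [/\ n != 0%R, eqn_tail_reduced l &
    w = inl_x a * (inr_x n * eqn_tail l) * inl_x b].
Proof.
have inlM a b : inl_x (a * b) = inl_x a * inl_x b by exact: gmulfM.
have inrM (m n : int) : inr_x (m + n)%R = inr_x m * inr_x n by exact: gmulfM.
have inl1 : inl_x 1 = 1 by exact: fp_inl1.
have inr1 : inr_x 0%R = 1 by exact: fp_inr1.
rewrite -[w]fp_reprK; elim: (fp_repr w) => [|[c|m] s IH].
- by left; exists 1; rewrite inl1.
- rewrite fp_word_cons -[fp_word [:: _]]/(inl_x c).
  case: IH => [[b ->]|[a [n [l [b [n0 lP ->]]]]]].
    by left; exists (c * b); rewrite inlM.
  by right; exists (c * a), n, l, b; split=> //; rewrite inlM !mulgA.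
rewrite fp_word_cons -[fp_word [:: _]]/(inr_x m).
have [m0|m0] := eqVneq (m : int) 0%R; first by rewrite m0 inr1 mul1g.
case: IH => [[b ->]|[a [n [l [b [n0 lP ->]]]]]].
  right; exists 1, m, [::], b; split=> //.
  by rewrite /eqn_tail big_nil inl1 mulg1 mul1g.
have [->|/eqP a1] := eqVneq a 1; last first.
  right; exists 1, m, ((a, n) :: l), b; split=> //.
    by move=> p; rewrite inE => /orP[/eqP ->|/lP].
  by rewrite /eqn_tail big_cons inl1 mul1g !mulgA.
have [mn0|mn0] := eqVneq (m + n)%R 0%R; last first.
  right; exists 1, (m + n)%R, l, b; split=> //.
  by rewrite inrM inl1 !mul1g !mulgA.
have mnE : inr_x m * (inl_x 1 * (inr_x n * eqn_tail l) * inl_x b) =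
    eqn_tail l * inl_x b.
  by rewrite inl1 mul1g !mulgA -inrM mn0 inr1 mul1g.
rewrite mnE; case: l lP {mnE} => [|[g k] l] lP.
  by left; exists b; rewrite /eqn_tail big_nil mul1g.
(* The powers of x have cancelled, and the first coefficient of the tail takes the role of [a]. *)
right; exists g, k, l, b; rewrite /eqn_tail big_cons /=; split=> //.
- by have [] := lP _ (mem_head _ _).
- by move=> p pl; apply: lP; rewrite inE pl orbT.
- by rewrite !mulgA.
Qed.

Lemma word_evalM (h : G) (v w : free_product G inf_cyclic) :
  word_eval h (v * w) = word_eval h v * word_eval h w.
Proof. exact: fp_liftM. Qed.

Lemma word_eval_tail h l : word_eval h (eqn_tail l) = tail_eval h l.
Proof.
rewrite /eqn_tail /tail_eval; elim: l => [|p l IH].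
  by rewrite !big_nil -(word_eval_const h 1); congr word_eval;
    exact/esym/fp_inl1.
by rewrite !big_cons !word_evalM word_eval_const IH [word_eval h (inr_x _)]fp_lift_inr.
Qed.

(** A constant equation holds everywhere or nowhere; otherwise the outer constants move to the
    right, giving c = a^-1 b^-1. *)
Lemma equation_trichotomy (w : free_product G inf_cyclic) :
  [\/ forall h, word_eval h w = 1, forall h, word_eval h w <> 1 |
      exists (n : int) l c, [/\ n != 0%R, eqn_tail_reduced l &
        forall h, word_eval h w = 1 -> zpow h n * tail_eval h l = c]].
Proof.
have [[b ->]|[a [n [l [b [n0 lP ->]]]]]] := equation_form w.
  by have [->|/eqP b1] := eqVneq b 1; [constructor 1|constructor 2] => h;
    rewrite word_eval_const.
constructor 3; exists n, l, (a^-1 * b^-1); split=> // h.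
rewrite !word_evalM !word_eval_const word_eval_tail [word_eval h (inr_x _)]fp_lift_inr.
by move=> e; apply: (mulgI a); apply: (mulIg b); rewrite e mulVKg mulVg.
Qed.

(** Constant equations without solution impose nothing; every other one contributes a triple to
    [W]. *)
Lemma equations_generic (s : seq (free_product G inf_cyclic)) :
  {in s, forall w, exists h, word_eval h w <> 1} ->
  exists2 W : seq (int * seq (G * int) * G),
    {in W, forall e, e.1.1 != 0%R /\ eqn_tail_reduced e.1.2} &
    forall h, {in W, forall e, zpow h e.1.1 * tail_eval h e.1.2 <> e.2} ->
      {in s, forall w, word_eval h w <> 1}.
Proof.
elim: s => [_|w s IH ws]; first by exists [::].
have [|W WP Ws] := IH; first by move=> v vs; apply: ws; rewrite inE vs orbT.
have [w1|w1|[n [l [c [n0 lP wE]]]]] := equation_trichotomy w.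
- by have [h []] := ws w (mem_head _ _); apply: w1.
- by exists W => // h /Ws sP v; rewrite inE => /orP[/eqP ->|/sP].
exists ((n, l, c) :: W) => [e|h hP v].
  by rewrite inE => /orP[/eqP ->|/WP].
rewrite inE => /orP[/eqP -> /wE|vs]; first exact: (hP _ (mem_head _ _)).
by apply: Ws vs => e eW; apply: hP; rewrite inE eW orbT.
Qed.

End Equations.

(** * Algebraic subgroups of free products *)

Lemma isomorphic_to_conj (K G : groupType) (H : set G) (y : G) :
  isomorphic_to K [set h ^ y | h in H] -> isomorphic_to K H.
Proof.
move=> [f [injf rf]].
have fyM : {morph (fun k => f k ^ y^-1) : k m / k * m}.
  by move=> k m; rewrite gmulfM conjMg.
pose F : {multiplicative K -> G} :=
  HB.pack (fun k => f k ^ y^-1) (isMultiplicative.Build K G _ fyM).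
exists F; split=> [k m /conjg_inj/injf //|].
apply/seteqP; split=> [_ [k _ <-]|h Hh] /=.
  have : range f (f k) by exists k.
  by rewrite rf => -[h Hh <-]; rewrite conjgK.
have : [set h ^ y | h in H] (h ^ y) by exists h.
by rewrite -rf => -[k _ fk]; exists k => //=; rewrite fk conjgK.
Qed.

Theorem corollary1p9 (A B : groupType)
    (ntA : exists a : A, a != 1) (ntB : exists b : B, b != 1)
    (H : set (free_product A B))
    (gH : subgroup H) (algH : algebraic H) :
  [\/ isomorphic_to inf_cyclic H \/ isomorphic_to inf_dihedral H,
      exists g : free_product A B,
        (exists2 K : set A, subgroup K & [set h ^ g | h in H] = fp_inl B @` K) \/
        (exists2 K : set B, subgroup K & [set h ^ g | h in H] = fp_inr A @` K)
    | H = setT].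
Proof.
have treeL := @syllables_tree A B.
(* Conjugating by [y] brings the axis of a hyperbolic element through the base point. *)
have [[u [y [Hu axu]]]|noax] := pselect (exists u y, H u /\
    axial (@syllables A B) (u ^ y)); last first.
  constructor 2; apply: elliptic_subgroup => // x y Hx ax.
  by apply: noax; exists x, y.
pose Hy := [set h ^ y | h in H].
have gHy : subgroup Hy by exact: subgroup_conj.
have Huy : Hy (u ^ y) by exists u.
have [el|nel] := pselect (forall g, Hy g -> axis_stab (u ^ y) g).
  constructor 1; have [iso|iso] := elementary_subgroup treeL axu gHy Huy el.
    by left; apply: isomorphic_to_conj iso.
  by right; apply: isomorphic_to_conj iso.
constructor 3; apply/seteqP; split=> // g _.
have [F HE] := (algebraicP H).1 algH; rewrite HE => s Fs.
(* A point [g] outside the union shows that no equation of [s] holds identically. *)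
apply: contrapT => ngs.
have [w ws|W WP Ws] := @equations_generic _ s.
  by exists g => gw; apply: ngs; exists w.
(* The generic element is found in the conjugate [Hy], so the equations are conjugated too. *)
pose Wy := [seq (e.1.1, [seq (p.1 ^ y, p.2) | p <- e.1.2], e.2 ^ y) | e <- W].
have [|h Hh hP] := @nonelementary_generic _ _ treeL _ _ Wy axu gHy Huy nel.
  move=> _ /mapP[e /WP[e0 eP] ->] /=; split=> // _ /mapP[p /eP[p1 p2] ->] /=.
  by split=> // /eqP; rewrite conjg_eq1 => /eqP.
case: Hh => v Hv vh.
have : (\bigcap_(s in F) \bigcup_(w in [set` s]) primitive_solution_set w) v.
  by rewrite -HE.
move=> /(_ s Fs)[w ws] vw; apply: (Ws v _ w ws vw) => e eW.
have := hP _ (map_f _ eW); rewrite /= -vh => ne; apply: contra_not ne => vE.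
by rewrite tail_evalJ -vE; congr ((_ * tail_eval _ _) ^ _); rewrite -map_comp;
  apply: map_id_in => -[p k] _ /=; rewrite conjgK.
Qed.
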